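(* Let $q>3$ be a prime with $q\not\equiv 1\pmod 4$. Up to isomorphism, there is a unique left brace of order $4q$ with cyclic additive group and with $|\ker\lambda|=q$. It is $(B,+,\circ)$ with $B=\mathbb{Z}_q\times\mathbb{Z}_4$ and $$\begin{pmatrix} n\\ m\end{pmatrix}+\begin{pmatrix} x\\ y\end{pmatrix}=\begin{pmatrix} n+x\\ m+y\end{pmatrix},\qquad \begin{pmatrix} n\\ m\end{pmatrix}\circ\begin{pmatrix} x\\ y\end{pmatrix}=\begin{pmatrix} n+(-1)^{\frac{m(m-1)}{2}}x\\ m+(-1)^m y\end{pmatrix}$$ where $0\le n,x\le q-1$ and $0\le m,y\le 3$ (components taken modulo $q$ and modulo $4$ respectively). In particular, $(B,\circ)\cong\mathbb{Z}_2\times(\mathbb{Z}_q\rtimes_{-1}\mathbb{Z}_2)$.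
   Context: A skew (left) brace is a triple $(B,+,\circ)$ where $(B,+)$ and $(B,\circ)$ are groups such that $a\circ(b+c)=a\circ b-a+a\circ c$ for all $a,b,c\in B$; it is a left brace if $(B,+)$ is abelian. The map $\lambda:(B,\circ)\to\mathrm{Aut}(B,+)$, $\lambda_a(b)=-a+a\circ b$, is a group homomorphism, with kernel $\ker\lambda$. Isomorphisms are bijections preserving both operations. $\mathbb{Z}_q\rtimes_{-1}\mathbb{Z}_2$ is the dihedral group of order $2q$. *)

(* Defs.v *)
From HB Require Import structures.
From mathcomp Require Import all_boot all_algebra all_fingroup all_solvable.

Set Implicit Arguments.
Unset Strict Implicit.
Unset Printing Implicit Defensive.

(* A skew brace structure on a carrier T.  The additive group need not be     *)
(* commutative, so it is not a zmodType.                                      *)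
Record skewBrace (T : Type) := SkewBrace {
  badd : T -> T -> T;
  bzero : T;
  bopp : T -> T;
  bcirc : T -> T -> T;
  bone : T;
  binv : T -> T;
  baddA : associative badd;
  badd0 : left_id bzero badd;
  baddN : left_inverse bzero bopp badd;
  bcircA : associative bcirc;
  bcirc1 : left_id bone bcirc;
  bcircV : left_inverse bone binv bcirc;
  bcircD : forall a b c,
    bcirc a (badd b c) = badd (badd (bcirc a b) (bopp a)) (bcirc a c)
}.

Definition left_brace (T : Type) (S : skewBrace T) : Prop :=
  commutative (badd S).

Definition blambda (T : Type) (S : skewBrace T) (a b : T) : T :=
  badd S (bopp S a) (bcirc S a b).

Definition ker_lambda (T : finType) (S : skewBrace T) : {set T} :=
  [set a | [forall b, blambda S a b == b]].

Definition brace_iso (T1 T2 : Type) (S1 : skewBrace T1) (S2 : skewBrace T2) :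
    Prop :=
  exists f : T1 -> T2,
    [/\ bijective f,
        {morph f : x y / badd S1 x y >-> badd S2 x y} &
        {morph f : x y / bcirc S1 x y >-> bcirc S2 x y}].

(* Two aliases of the carrier, bearing respectively the groups (B, +) and     *)
(* (B, o) as finGroupType instances (both written multiplicatively).          *)
Definition add_group (T : finType) (S : skewBrace T) : Type := T.
Definition circ_group (T : finType) (S : skewBrace T) : Type := T.

HB.instance Definition _ (T : finType) (S : skewBrace T) :=
  Finite.on (add_group S).
HB.instance Definition _ (T : finType) (S : skewBrace T) :=
  Finite_isGroup.Build (add_group S) (@baddA T S) (@badd0 T S) (@baddN T S).

HB.instance Definition _ (T : finType) (S : skewBrace T) :=
  Finite.on (circ_group S).
HB.instance Definition _ (T : finType) (S : skewBrace T) :=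
  Finite_isGroup.Build (circ_group S) (@bcircA T S) (@bcirc1 T S) (@bcircV T S).

(* Main.v *)
(* Endomorphisms of (Z_q x Z_4, +) are multiplications in the product ring,   *)
(* so a brace on this group is a map U with a o b = a + U(a) b and            *)
(* U(a + U(a) b) = U(a) U(b).  A kernel of order q must be Z_q x 0; hence     *)
(* U(n, m) depends on m only, and injectively.  Injectivity forces            *)
(* U(0, 2) = (-1, 1) and U(0, 1), U(0, -1) to be (1, -1), (-1, -1) in some    *)
(* order: the alternative needs a square root of -1 modulo q, excluded since  *)
(* q = 3 mod 4.  The two orders are exchanged by m |-> - m.                   *)
(* In (B, o) the central involution (0, 1) splits off the subgroup            *)
(* {(n, m) | m even}, generated by the involutions (0, 2) and (1, 2) and thus *)
(* dihedral.                                                                  *)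

Require Import Defs.
From mathcomp Require Import all_boot all_algebra all_fingroup all_solvable.
From mathcomp Require Import finfield.

Set Implicit Arguments.
Unset Strict Implicit.
Unset Printing Implicit Defensive.

Import GRing.Theory.

Local Open Scope ring_scope.

(** The map lambda of a brace on Z_q x Z_4 is a family of multipliers [U] ([additive_Zq4]);
    conversely [multiplier_brace] builds a brace from involutive multipliers. [mult_snd] and
    [mult_inj] turn [U] into an injective map on Z_4, and [mult_classification] determines it up to
    a sign of m. [dihedral_brace_unique] transports any brace to this model and absorbs the sign in
    an automorphism; [circ_group_isog] splits the circle group. *)

Section MultiplierBrace.

Variables (R : comNzRingType) (U : R -> R).
Hypothesis U0 : U 0 = 1.
Hypothesis UM : forall a b, U (a + U a * b) = U a * U b.
Hypothesis UU : forall a, U a * U a = 1.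

Let circ a b := a + U a * b.

Fact multiplier_circA : associative circ.
Proof. by move=> a b c; rewrite /circ UM mulrDr mulrA addrA. Qed.

Fact multiplier_circ0 : left_id 0 circ.
Proof. by move=> a; rewrite /circ U0 mul1r add0r. Qed.

Fact multiplier_circV : left_inverse 0 (fun a => - (U a * a)) circ.
Proof.
move=> a; rewrite /circ; have -> : U (- (U a * a)) = U a.
  (* Insert U(a) U(a) = 1 and merge one factor by [UM]: U(a - a) = 1 remains. *)
  by rewrite -[LHS]mul1r -(UU a) -mulrA -UM mulrN (mulrA (U a) (U a) a) UU
    mul1r subrr U0 mulr1.
by rewrite addNr.
Qed.

Fact multiplier_circD a b c : circ a (b + c) = circ a b + (- a) + circ a c.
Proof.
by rewrite /circ mulrDr (addrAC a (U a * b)) subrr add0r [RHS]addrCA.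
Qed.

Definition multiplier_brace : skewBrace R :=
  SkewBrace (@addrA R) (@add0r R) (@addNr R) multiplier_circA
    multiplier_circ0 multiplier_circV multiplier_circD.

End MultiplierBrace.

(** * Square roots of 1 and -1 modulo q; arithmetic modulo 4 *)

Section PrimeField.

Variable q : nat.
Hypothesis q_prime : prime q.

Lemma Zp_prime_sqr1 (x : 'Z_q) : x * x = 1 -> x = 1 \/ x = -1.
Proof.
(* ['F_q] is ['Z_(pdiv q)], so this rewriting moves [x] into a field. *)
move: x; rewrite -(pdiv_id q_prime) => x.
have := @sqrf_eq1 'F_q x; rewrite expr2 => Ex xx1.
by move: Ex; rewrite xx1 eqxx => /esym/orP[]/eqP; [left | right].
Qed.

(** With q = 2(2k + 1) + 1, a root x of -1 has x^q = (-1)^(2k+1) x = -x, while Fermat gives x^q = x;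
    hence 2x = 0 with q odd. *)
Lemma Zp_prime_sqrN1 (x : 'Z_q) : q = 3 %[mod 4] -> x * x <> -1.
Proof.
move=> q3; move: x; rewrite -(pdiv_id q_prime) => x xxN1.
have q_eq : q = (2 * (2 * (q %/ 4)).+1).+1.
  by rewrite [LHS](divn_eq q 4) q3 (mulnS 2) (mulnA 2 2) (mulnC (2 * 2)%N)
    addnC.
have xq : x ^+ q = x by have := @expf_card 'F_q x; rewrite card_Fp.
have xN : x = - x.
  rewrite -[LHS]xq; transitivity (x ^+ (2 * (2 * (q %/ 4)).+1).+1).
    by congr (_ ^+ _).
  by rewrite exprSr exprM expr2 xxN1 exprS exprM sqrrN !expr1n mulr1 mulN1r.
have two0 : (2%:R : 'F_q) <> 0.
  move/eqP; rewrite -(dvdn_pcharf (pchar_Fp q_prime)) dvdn_prime2 //.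
  by move/eqP=> q2; rewrite q2 in q3.
have : 2%:R * x = 0 by rewrite mulr_natl mulr2n {2}xN subrr.
move/eqP; rewrite mulf_eq0 => /orP[]/eqP // x0.
by move/eqP: xxN1; rewrite x0 mul0r eq_sym oppr_eq0 oner_eq0.
Qed.
End PrimeField.

Lemma Z4_cases (m : 'Z_4) : [\/ m = 0, m = 1, m = 2%:R | m = -1].
Proof.
by case: m => [[|[|[|[|//]]]] ?]; [constructor 1 | constructor 2 | constructor 3
  | constructor 4]; apply: val_inj.
Qed.

Lemma Z4_unit (a b : 'Z_4) : a * b = 1 -> b = 1 \/ b = -1.
Proof.
by case: (Z4_cases a) => ->; case: (Z4_cases b) => -> /eqP //; [left | right].
Qed.

Lemma Z4_mulrn_eq0 (k : nat) (m : 'Z_4) : k = 3 %[mod 4] -> m *+ k = 0 -> m = 0.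
Proof.
move=> k3; have m4 : m *+ 4 = 0 by case: (Z4_cases m) => ->; apply: val_inj.
rewrite (divn_eq k 4) k3 mulnC mulrnDr mulrnA m4 mul0rn add0r.
by case: (Z4_cases m) => -> /eqP.
Qed.

(** Computed in the natural numbers, where truncation at m = 0 is harmless: true exactly at 2 and
    3. *)
Definition Z4_sign (m : 'Z_4) : bool := odd ((m * (m - 1)) %/ 2)%N.

(** Under m + (-1)^m y, Z_4 is a Klein four-group; this sign and the parity are its two
    coordinates. *)
Lemma Z4_signD (m y : 'Z_4) :
  Z4_sign (m + (- 1) ^+ (m : nat) * y) = Z4_sign m (+) Z4_sign y.
Proof.
by case: (Z4_cases m) => ->; case: (Z4_cases y) => ->.
Qed.

Lemma Z4_parityD (m y : 'Z_4) :
  odd (m + (- 1) ^+ (m : nat) * y)%R = odd m (+) odd y.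
Proof.
by case: (Z4_cases m) => ->; case: (Z4_cases y) => ->.
Qed.

(** * The model brace *)

Section Multiplier.

Variable q : nat.

Definition lambda_mult (a : 'Z_q * 'Z_4) : 'Z_q * 'Z_4 :=
  ((- 1) ^+ ((a.2 * (a.2 - 1)) %/ 2)%N, (- 1) ^+ (a.2 : nat)).

Lemma lambda_multE a :
  lambda_mult a = ((- 1) ^+ Z4_sign a.2, (- 1) ^+ odd a.2).
Proof.
by rewrite /lambda_mult -[in LHS]signr_odd -[in X in (_, X)]signr_odd.
Qed.

Lemma lambda_mult0 : lambda_mult 0 = 1.
Proof. by rewrite lambda_multE. Qed.

Lemma lambda_multM a b :
  lambda_mult (a + lambda_mult a * b) = lambda_mult a * lambda_mult b.
Proof.
rewrite [LHS]lambda_multE.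
rewrite -[(_ + _).2]/(a.2 + (-1) ^+ (a.2 : nat) * b.2).
by rewrite Z4_signD Z4_parityD !signr_addb !lambda_multE.
Qed.

Lemma lambda_mult_sqr a : lambda_mult a * lambda_mult a = 1.
Proof. by rewrite lambda_multE; congr (_, _); rewrite -expr2 sqrr_sign. Qed.

Definition dihedral_brace : skewBrace ('Z_q * 'Z_4)%type :=
  multiplier_brace lambda_mult0 lambda_multM lambda_mult_sqr.

End Multiplier.

(** * Additive group and kernel of the model *)

Section Brace.
Variable q : nat.
Hypotheses (q_prime : prime q) (q_gt3 : (3 < q)%N).
Let q_gt1 : (1 < q)%N := ltn_trans (isT : 1 < 3)%N q_gt3.

Lemma card_Zq4 : #|{: 'Z_q * 'Z_4}| = (4 * q)%N.
Proof. by rewrite card_prod !card_ord /= Zp_cast // mulnC. Qed.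

(** Chinese remainders, q being odd. *)
Lemma Zq4_mulrn (a : 'Z_q * 'Z_4) : exists k, a = 1 *+ k.
Proof.
have co_q4 : coprime q 4.
  apply: (@coprimeXr 2 q 2); rewrite prime_coprime // dvdn_prime2 //.
  by apply: contraTneq q_gt3 => ->.
case: a => n m; exists (chinese q 4 n m).
have mulrn_pair k : (1 : 'Z_q * 'Z_4) *+ k = (k%:R, k%:R).
  by elim: k => // k IHk; rewrite [LHS]mulrS IHk ![in RHS]mulrS.
rewrite mulrn_pair; congr (_, _).
  by rewrite -Zp_nat_mod // chinese_modl // Zp_nat_mod // natr_Zp.
by rewrite -Zp_nat_mod // chinese_modr // Zp_nat_mod // natr_Zp.
Qed.

Lemma additive_Zq4 (phi : 'Z_q * 'Z_4 -> 'Z_q * 'Z_4) :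
  {morph phi : x y / x + y} -> forall a, phi a = phi 1 * a.
Proof.
move=> phiD a; have phi0 : phi 0 = 0.
  by apply: (addrI (phi 0)); rewrite -phiD !addr0.
have [k ->] := Zq4_mulrn a; rewrite mulrnAr mulr1.
by elim: k => // k IHk; rewrite !mulrS phiD IHk.
Qed.

Lemma dihedral_brace_cyclic : cyclic [set: add_group (dihedral_brace q)].
Proof.
apply/cyclicP; exists (1 : 'Z_q * 'Z_4); apply/esym/setP => a; rewrite [RHS]inE.
apply/cycleP; have [k ->] := Zq4_mulrn a; exists k.
by elim: k => // k IHk; rewrite mulrS IHk expgS.
Qed.

Lemma sign_Zq_eq1 (b : bool) : ((-1) ^+ b == 1 :> 'Z_q) = ~~ b.
Proof.
case: b; last exact: eqxx.
apply/negbTE; rewrite eq_sym -addr_eq0 -[1 + 1]/(2%:R).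
apply/eqP => /(congr1 (@nat_of_ord _)).
by rewrite val_Zp_nat // modn_small // ltnW.
Qed.

Lemma lambda_mult_eq1 (a : 'Z_q * 'Z_4) : (lambda_mult a == 1) = (a.2 == 0).
Proof.
by rewrite lambda_multE xpair_eqE sign_Zq_eq1; case: (Z4_cases a.2) => ->.
Qed.

Lemma card_fiber_Zq4 (m : 'Z_4) :
  #|[set a : 'Z_q * 'Z_4 | a.2 == m]| = q.
Proof.
have -> : [set a : 'Z_q * 'Z_4 | a.2 == m] = setX setT [set m].
  by apply/setP => a; rewrite !inE.
by rewrite cardsX cards1 muln1 cardsT card_ord Zp_cast.
Qed.

Lemma card_ker_dihedral_brace : #|ker_lambda (dihedral_brace q)| = q.
Proof.
rewrite -[RHS](card_fiber_Zq4 0); apply: eq_card => a; rewrite !inE.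
rewrite -lambda_mult_eq1; apply/forallP/eqP => [/(_ 1)/eqP | Ua1 b].
  by rewrite /blambda /= addKr mulr1.
by rewrite /blambda /= addKr Ua1 mul1r.
Qed.

(** * Classification of the multipliers *)

Section Uniqueness.
Hypothesis q_mod4 : q = 3 %[mod 4].
Variable U : 'Z_q * 'Z_4 -> 'Z_q * 'Z_4.
Hypothesis UM : forall a b, U (a + U a * b) = U a * U b.
Hypothesis UV : forall a, exists v, v * U a = 1.
Hypothesis cardU1 : #|[set a | U a == 1]| = q.

Lemma mult0 : U 0 = 1.
Proof.
by have [v vU] := UV 0; rewrite -[LHS]mul1r -vU -mulrA -UM mulr0 addr0.
Qed.

(* Translation by [a] permutes the kernel [K = U @^-1: [set 1]]; comparing    *)
(* the sums of the elements of [K] before and after gives [#|K| a = 0].       *)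
Lemma mult1_snd a : U a = 1 -> a.2 = 0.
Proof.
move=> Ua; have addK b : (U (a + b) == 1) = (U b == 1).
  by rewrite -[b in LHS]mul1r -Ua UM Ua mul1r.
have aq : a *+ q = 0.
  apply: (addIr (\sum_(b | U b == 1) b)); rewrite add0r.
  rewrite [RHS](reindex_inj (addrI a)) (eq_bigl _ _ addK) big_split sumr_const.
  congr (_ *+ _ + _).
  by rewrite -[LHS]cardU1; apply: eq_card => b; rewrite inE.
by apply: (Z4_mulrn_eq0 q_mod4); rewrite -raddfMn aq.
Qed.

Lemma mult_eq1 a : (U a == 1) = (a.2 == 0).
Proof.
have sub : [set a | U a == 1] \subset [set a : 'Z_q * 'Z_4 | a.2 == 0].
  by apply/subsetP => b; rewrite !inE => /eqP/mult1_snd ->.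
have /eqP/setP/(_ a) : [set a | U a == 1] == [set a : 'Z_q * 'Z_4 | a.2 == 0].
  by rewrite eqEcard sub cardU1 card_fiber_Zq4 /=.
by rewrite !inE.
Qed.

Let w m := U (0, m).

(** (n, m) is the circle product of (n, 0), which lies in the kernel, and (0, m). *)
Lemma mult_snd a : U a = w a.2.
Proof.
have Ua0 : U (a.1, 0) = 1 by apply/eqP; rewrite mult_eq1.
case: a Ua0 => n m /= Un0; rewrite -[RHS]mul1r -Un0 -UM Un0 mul1r.
by congr (U (_, _)); rewrite ?addr0 ?add0r.
Qed.

Lemma mult_inj : injective w.
Proof.
(* [c] is the circle quotient: (0, m) o c = (0, y), so [c] lies in the kernel. *)
move=> m y wE; have [v vw] := UV (0, m); pose c := v * ((0, y) - (0, m)).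
have Uc : w m * U c = w m.
  by rewrite -UM [U (0, m) * _]mulrA (mulrC _ v) vw mul1r addrC subrK
    -/(w y) wE.
have {}Uc : U c = 1 by rewrite -[LHS]mul1r -vw -mulrA Uc.
have := mult1_snd Uc => c0; have : ((0, y) - (0, m) : 'Z_q * 'Z_4).2 = 0.
  have -> : (0, y) - (0, m) = w m * c by rewrite /c mulrA (mulrC _ v) vw mul1r.
  by rewrite -[RHS](mulr0 (w m).2) -c0.
by move/eqP; rewrite subr_eq0 => /eqP.
Qed.

Lemma mult_sndM m y : w (m + (w m).2 * y) = w m * w y.
Proof. by rewrite -UM mult_snd. Qed.

Lemma mult_classification : exists2 s : 'Z_4, s * s = 1 &
  forall a, U a = lambda_mult (a.1, s * a.2).
Proof.
have w0 : w 0 = 1 := mult0.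
have u_sqr m : w m * w m = 1 -> (w m).1 = 1 \/ (w m).1 = -1.
  by move=> ww; apply: (Zp_prime_sqr1 q_prime); rewrite -[RHS](congr1 fst ww).
have w_neq m y x z : w m = (x, z) -> m <> y -> (w y).2 = z -> (w y).1 <> x.
  move=> wm my wy2 wy1; apply: my; apply: mult_inj.
  by rewrite wm -wy1 -wy2 -surjective_pairing.
(* Here w(2)^2 = w(2 + 2) = 1, and injectivity excludes w(2) = 1. *)
have w2_sqr : (w 2%:R).2 = 1 -> (w 2%:R).1 = -1.
  move=> v2; have [||//] := u_sqr 2%:R.
    by rewrite -mult_sndM v2 mul1r -w0; congr w; apply: val_inj.
  by move/(w_neq 0 2%:R 1 1 w0)=> [].
(* Otherwise w(2) = w(m)^2 has second component 1, hence first component -1, a square. *)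
have v_odd m : m + m = 2%:R -> (w m).2 = -1.
  move=> mm; have [v vw] := UV (0, m).
  have [v1|//] : (w m).2 = 1 \/ (w m).2 = -1.
    by apply: (@Z4_unit v.2); rewrite -[RHS](congr1 snd vw).
  have w2 : w 2%:R = w m * w m by rewrite -mult_sndM v1 mul1r mm.
  case: (@Zp_prime_sqrN1 _ q_prime (w m).1 q_mod4).
  by rewrite -w2_sqr w2 //= v1 mul1r.
have v1 : (w 1).2 = -1 by apply: v_odd.
have vN1 : (w (-1)).2 = -1 by apply: v_odd; apply: val_inj.
have v2 : (w 2%:R).2 = 1.
  have /(congr1 snd)/= := mult_sndM 1 2%:R; rewrite v1.
  have -> : 1 + -1 * 2%:R = -1 :> 'Z_4 by apply: val_inj.
  by rewrite vN1 mulN1r => /oppr_inj <-.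
have w2 : w 2%:R = (-1, 1) by rewrite [LHS]surjective_pairing w2_sqr // v2.
have wN m : (w m).2 = -1 -> (w m).1 = 1 \/ (w m).1 = -1.
  by move=> vm; apply: u_sqr; rewrite -mult_sndM vm mulN1r subrr.
have [u1 uN1] := (wN 1 v1, wN (-1) vN1).
have uneq : (w 1).1 <> (w (-1)).1.
  move=> u11; suff /mult_inj/(congr1 val) : w 1 = w (-1) by [].
  by rewrite [LHS]surjective_pairing [RHS]surjective_pairing u11 v1 vN1.
have [[w1 wN1]|[w1 wN1]] : (w 1 = (1, -1) /\ w (-1) = (-1, -1)) \/
    (w 1 = (-1, -1) /\ w (-1) = (1, -1)).
- rewrite [w 1]surjective_pairing [w (-1)]surjective_pairing v1 vN1.
  by case: u1 uneq => ->; case: uN1 => -> //; [left | right].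
- exists 1 => [|a]; first exact: val_inj.
  rewrite mult_snd mul1r lambda_multE /=.
  by case: (Z4_cases a.2) => ->; rewrite ?w0 ?w1 ?w2 ?wN1.
exists (-1) => [|a]; first exact: val_inj.
rewrite mult_snd lambda_multE /=.
by case: (Z4_cases a.2) => ->; rewrite ?w0 ?w1 ?w2 ?wN1.
Qed.

End Uniqueness.

Lemma dihedral_brace_unique (T : finType) (S : skewBrace T) :
  q = 3 %[mod 4] -> #|T| = (4 * q)%N -> cyclic [set: add_group S] ->
  #|ker_lambda S| = q -> brace_iso S (dihedral_brace q).
Proof.
move=> q_mod4 oT cycS kerS.
have /isogP[f /injmP f_inj _] :
    [set: add_group S] \isog [set: add_group (dihedral_brace q)].
  rewrite isog_cyclic_card // dihedral_brace_cyclic /= !cardsT; apply/eqP.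
  transitivity #|T|; first by rewrite oT -card_Zq4.
  pose id_add : T -> add_group S := id.
  by apply: (bij_eq_card (f := id_add)); exists id.
have {}f_inj : injective (f : T -> 'Z_q * 'Z_4).
  by move=> a b; apply: f_inj; rewrite inE.
have fD : {morph (f : T -> 'Z_q * 'Z_4) : a b / badd S a b >-> a + b}.
  by move=> a b; apply: (morphM f); rewrite inE.
have [g fK gK] : bijective (f : T -> 'Z_q * 'Z_4).
  by apply: inj_card_bij; rewrite // card_Zq4 oT.
have lambdaD a : {morph blambda S a : b c / badd S b c}.
  by move=> b c; rewrite /blambda bcircD !baddA.
(* An additive map is multiplication by its value at 1. *)
pose U a := f (blambda S (g a) (g 1)) : 'Z_q * 'Z_4.
have fU a b : f (blambda S a b) = U (f a) * f b.
  pose phi c := f (blambda S a (g c)) : 'Z_q * 'Z_4.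
  have phiD : {morph phi : c d / c + d}.
    move=> c d; rewrite -fD -lambdaD; congr (f (blambda S a _)).
    by apply: f_inj; rewrite fD !gK.
  by rewrite /U fK -(additive_Zq4 phiD) /phi fK.
have f0 : f (bzero S) = 0 :> 'Z_q * 'Z_4.
  by apply: (addrI (f (bzero S))); rewrite -fD badd0 addr0.
have fN a : f (bopp S a) = - (f a : 'Z_q * 'Z_4).
  by apply: (addIr (f a)); rewrite -fD baddN addNr.
have fM a b : f (bcirc S a b) = f a + U (f a) * f b :> 'Z_q * 'Z_4.
  by rewrite -fU /blambda fD fN addrA subrr add0r.
have f_onto P : (forall a, P (f a)) -> forall b, P b.
  by move=> Pf b; rewrite -[b]gK.
have UM a b : U (a + U a * b) = U a * U b.
  elim/f_onto: a; elim/f_onto: b => b a; rewrite -fM.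
  (* Associativity at the preimage of 1 compares the multipliers themselves. *)
  have := congr1 f (esym (bcircA S a b (g 1))).
  by rewrite !fM gK !mulr1 mulrDr addrA => /addrI.
have fone : f (bone S) = 0 :> 'Z_q * 'Z_4.
  by have := fM (bone S) (bzero S); rewrite bcirc1 f0 mulr0 addr0.
have Uone : U 0 = 1.
  by have := fM (bone S) (g 1); rewrite bcirc1 gK fone add0r mulr1.
have UV a : exists v, v * U a = 1.
  elim/f_onto: a => a; exists (U (f (binv S a))).
  by rewrite -UM -fM bcircV fone.
have cardU1 : #|[set a | U a == 1]| = q.
  rewrite -[RHS]kerS -(card_imset _ f_inj); apply: eq_card => a.
  elim/f_onto: a => a; rewrite mem_imset // !inE.
  apply/eqP/forallP => [Ua b | ka].
    by apply/eqP/f_inj; rewrite fU Ua mul1r.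
  by rewrite -[LHS]mulr1 -[1 in LHS]gK -fU (eqP (ka _)) gK.
have [s ss US] := mult_classification q_mod4 UM UV cardU1.
(* This additive involution carries [U] to [lambda_mult]. *)
pose h (a : 'Z_q * 'Z_4) : 'Z_q * 'Z_4 := (a.1, s * a.2).
have hK : involutive h by move=> [n m]; rewrite /h /= mulrA ss mul1r.
exists (h \o f); split.
- by apply: bij_comp; [exact: inv_bij | exists g].
- by move=> a b; rewrite /= fD /h /= mulrDr.
- by move=> a b; rewrite /= fM US /h /= mulrDr mulrCA.
Qed.

(** * Structure of the circle group *)

Section CircleGroup.
Local Open Scope group_scope.

Let gT : finGroupType := circ_group (dihedral_brace q).
Let z : gT := (0, 1)%R.
Let x : gT := (0, 2%:R)%R.
Let y : gT := (1, 2%:R)%R.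

Let parityM (a b : gT) : odd (a * b).2 = odd a.2 (+) odd b.2.
Proof. exact: Z4_parityD. Qed.

Let rotationX k : ((1, 0)%R : gT) ^+ k = (k%:R, 0)%R.
Proof.
elim: k => // k IHk; rewrite expgS IHk.
by congr (_, _); rewrite /= mul1r ?addr0 // [RHS]mulrS.
Qed.

Lemma even_subgroupE : <<[set x; y]>> = [set a : gT | ~~ odd a.2].
Proof.
have grp : group_set [set a : gT | ~~ odd a.2].
  apply/group_setP; split=> [|a b]; first by rewrite inE.
  by rewrite !inE parityM => /negbTE-> /negbTE->.
apply/eqP; rewrite eqEsubset; apply/andP; split.
  by rewrite (gen_subG _ (Group grp)) subUset !sub1set !inE.
have xD : x \in <<[set x; y]>> by rewrite mem_gen ?inE ?eqxx.
have yD : y \in <<[set x; y]>> by rewrite mem_gen ?inE ?eqxx ?orbT.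
have rotD n : ((n, 0)%R : gT) \in <<[set x; y]>>.
  (* The product of the two involutions is the rotation (1, 0). *)
  suff -> : ((n, 0)%R : gT) = (y * x) ^+ n by rewrite groupX ?groupM.
  have -> : y * x = ((1, 0)%R : gT).
    by congr (_, _); [rewrite /= mulr0 addr0 | apply: val_inj].
  by rewrite rotationX natr_Zp.
apply/subsetP=> -[n m]; rewrite inE /=; case: (Z4_cases m) => -> //= _.
suff -> : ((n, 2%:R)%R : gT) = ((n, 0)%R : gT) * x by apply: groupM (rotD n) xD.
by apply/esym; congr (_, _); [rewrite /= mulr0 addr0 | apply: val_inj].
Qed.

(** Two distinct involutions generate a dihedral group; the index of ['D_] is its order. *)
Lemma even_subgroup_isog : <<[set x; y]>> \isog 'D_(2 * q).
Proof.
have ox : #[x] = 2.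
  apply: nt_prime_order => //; rewrite expgS expg1.
  by congr (_, _); [rewrite /= mulr0 addr0 | apply: val_inj].
have oy : #[y] = 2.
  apply: nt_prime_order => //; rewrite expgS expg1.
  by congr (_, _); [rewrite /= mulr1 subrr | apply: val_inj].
have := involutions_gen_dihedral ox oy; rewrite even_subgroupE.
have -> : #|[set a : gT | ~~ odd a.2]| = (2 * q)%N.
  have -> : [set a : gT | ~~ odd a.2] =
      setX [set: 'Z_q] [set m : 'Z_4 | ~~ odd m].
    by apply/setP => -[n m]; rewrite !inE.
  rewrite cardsX cardsT card_ord Zp_cast // mulnC; congr (_ * _)%N.
  have -> : [set m : 'Z_4 | ~~ odd m] = [set 0%R; 2%:R%R].
    by apply/setP => m; rewrite !inE; case: (Z4_cases m) => ->.
  by rewrite cards2.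
by apply; rewrite xpair_eqE.
Qed.

Lemma circ_group_isog : [set: gT] \isog [set: ('Z_2 * 'D_(2 * q))%type].
Proof.
have oz : #[z] = 2.
  apply: nt_prime_order => //; rewrite expgS expg1.
  by congr (_, _); [rewrite /= mulr0 addr0 | apply: val_inj].
have zC (a : gT) : commute z a.
  case: a => n m; congr (_, _); rewrite /= ?mul1r ?mulr0 ?addr0 ?add0r //.
  by case: (Z4_cases m) => ->; apply: val_inj.
have dprodG : <[z]> \x <<[set x; y]>> = [set: gT].
  rewrite dprodE; last 2 first.
  - apply/centsP => a _ b /cycleP[k ->].
    by apply: commuteX; apply: commute_sym.
  - apply: prime_TIg; first by rewrite -orderE oz.
    by rewrite cycle_subG /= even_subgroupE inE.
  apply/setP => a; rewrite [RHS]inE.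
  (* Multiplying by [z] flips the parity, so an odd [a] is [z^-1] times an even element. *)
  case: (boolP (odd a.2)) => ao; last first.
    rewrite -[a]mul1g; apply: mem_mulg; first exact: group1.
    by rewrite /= even_subgroupE inE.
  rewrite -[a](mulKg z); apply: mem_mulg; first by rewrite groupV cycle_id.
  by rewrite /= even_subgroupE inE parityM ao.
have dprodX : setX [set: 'Z_2] 1 \x setX 1 [set: 'D_(2 * q)] =
    [set: ('Z_2 * 'D_(2 * q))%type].
  by rewrite setX_dprod; apply/setP => -[a b]; rewrite !inE.
apply: (isog_dprod dprodG dprodX).
- apply: isog_trans (isog_setX1 _ _); rewrite isog_cyclic_card ?cycle_cyclic //.
  by rewrite -orderE oz cardsT card_ord prime_cyclic // cardsT card_ord.
apply: isog_trans (isog_set1X _ _); exact: even_subgroup_isog.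
Qed.
End CircleGroup.

End Brace.

Lemma prime_mod4 q : prime q -> (3 < q)%N -> q <> 1 %[mod 4] -> q = 3 %[mod 4].
Proof.
move=> q_prime q_gt3 q_mod4.
have q_odd : odd q by have [q2|//] := even_prime q_prime; rewrite q2 in q_gt3.
have : odd (q %% 4) by rewrite odd_mod.
by move: q_mod4 (ltn_pmod q (isT : 0 < 4)%N); case: (q %% 4)%N => [|[|[|[|]]]].
Qed.

Local Close Scope ring_scope.

Theorem lemma7p2 (q : nat) (q_prime : prime q) (q_gt3 : 3 < q)
    (q_mod4 : q <> 1 %[mod 4]) :
  exists B : skewBrace ('Z_q * 'Z_4)%type,
    [/\ (* the operations of B *)
        (forall (n x : 'Z_q) (m y : 'Z_4),
           badd B (n, m) (x, y) = ((n + x)%R, (m + y)%R)),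
        (forall (n x : 'Z_q) (m y : 'Z_4),
           bcirc B (n, m) (x, y) =
             ((n + (- 1) ^+ ((m * (m - 1)) %/ 2)%N * x)%R,
              (m + (- 1) ^+ (m : nat) * y)%R)),
        (* B is a left brace with the required properties *)
        [/\ left_brace B, #|{: 'Z_q * 'Z_4}| = 4 * q,
            cyclic [set: add_group B] & #|ker_lambda B| = q],
        (* B is the only one up to isomorphism *)
        (forall (T : finType) (S : skewBrace T),
           left_brace S -> #|T| = 4 * q ->
           cyclic [set: add_group S] -> #|ker_lambda S| = q ->
           brace_iso S B) &
        (* the multiplicative group of B *)
        [set: circ_group B] \isog [set: ('Z_2 * 'D_(2 * q))%type]].
Proof.
exists (dihedral_brace q); split=> //.
- split; [exact: addrC | exact: card_Zq4 | exact: dihedral_brace_cyclic |].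
  exact: card_ker_dihedral_brace.
- by move=> T S _; apply: dihedral_brace_unique => //; apply: prime_mod4.
exact: circ_group_isog.
Qed.
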